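(* Let $c>\frac12$ and $\delta>0$ be fixed. Let $\ell\ge4$ and let $\ell_1,\ell_2,\ell_3,\ell_4$ be positive integers with $\ell_1+\ell_2+\ell_3+\ell_4=\ell$. For $\mathbf y_1,\dots,\mathbf y_{\ell-2}\in\mathbb R^n$ and $\varepsilon_1,\dots,\varepsilon_{\ell-2}\in\{1,-1\}$ put $$I_{\mathbf y}=V_n^{-2\ell c}\int_{\mathbb R^n}\int_{\mathbb R^n}f_{c,\delta}(\mathbf x_1)\prod_{i=1}^{\ell_1-1}f_{c,\delta}(\varepsilon_i\mathbf x_1+\mathbf y_i)\; f_{c,\delta}(\mathbf x_2)\prod_{i=\ell_1}^{\ell_1+\ell_2-2}f_{c,\delta}(\varepsilon_i\mathbf x_2+\mathbf y_i)$$ $$\times\prod_{i=\ell_1+\ell_2-1}^{\ell_1+\ell_2+\ell_3-2}f_{c,\delta}\big(\varepsilon_i(\mathbf x_1+\mathbf x_2)+\mathbf y_i\big)\prod_{i=\ell_1+\ell_2+\ell_3-1}^{\ell-2}f_{c,\delta}\big(\varepsilon_i(\mathbf x_1-\mathbf x_2)+\mathbf y_i\big)\,d\mathbf x_1\,d\mathbf x_2 .$$ Then there exist constants $K>0$ and $0<\rho<1$, depending only on $\ell,c,\delta$ (and not on $n$, the $\varepsilon_i$ or the $\mathbf y_i$), such that $I_{\mathbf y}\le K\rho^n$ for all $n\ge1$, all $\varepsilon_i\in\{\pm1\}$ and all $\mathbf y_i\in\mathbb R^n$.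
   Context: $V_n=\pi^{n/2}/\Gamma(\frac n2+1)$ is the volume of the unit ball in $\mathbb R^n$, $R_n(\delta)=(\delta/V_n)^{1/n}$, and $f_{c,\delta}:\mathbb R^n\to\mathbb R$ is $f_{c,\delta}(\mathbf x)=|\mathbf x|^{-2cn}$ if $|\mathbf x|>R_n(\delta)$ and $f_{c,\delta}(\mathbf x)=0$ otherwise. Empty products equal $1$. *)

(* Defs.v *)
From HB Require Import structures.
From mathcomp Require Import all_boot all_order all_algebra.
From mathcomp Require Import all_classical all_reals all_analysis.
Set Implicit Arguments. Unset Strict Implicit. Unset Printing Implicit Defensive.
Import Order.TTheory GRing.Theory Num.Theory.
Local Open Scope ring_scope.

Definition vec (R : realType) (n : nat) := 'I_n -> R.

Definition vadd {R : realType} {n : nat} (x y : vec R n) : vec R n := fun i => x i + y i.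
Definition vsub {R : realType} {n : nat} (x y : vec R n) : vec R n := fun i => x i - y i.
Definition vscale {R : realType} {n : nat} (a : R) (x : vec R n) : vec R n := fun i => a * x i.

Definition enorm {R : realType} {n : nat} (x : vec R n) : R :=
  Num.sqrt (\sum_(i < n) x i ^+ 2).

Definition vcons {R : realType} {m : nat} (t : R) (v : vec R m) : vec R m.+1 :=
  fun i => if unlift ord0 i is Some j then v j else t.

(* Lebesgue integral over R^n of a nonnegative (extended-real valued) function,
   written as the n-fold iterated one-dimensional Lebesgue integral
   (equal to the integral w.r.t. n-dimensional Lebesgue measure by Tonelli,
   for nonnegative measurable integrands). *)
Fixpoint intRn {R : realType} (n : nat) : (vec R n -> \bar R) -> \bar R :=
  match n return (vec R n -> \bar R) -> \bar R with
  | 0 => fun F => F (fun i => 0)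
  | m.+1 => fun F =>
      (\int[@lebesgue_measure R]_(t in [set: R]) intRn (fun v => F (vcons t v)))%E
  end.

Definition Gamma {R : realType} (s : R) : R :=
  fine (\int[@lebesgue_measure R]_(t in [set t : R | (0 < t)%R])
          ((powR t (s - 1)) * expR (- t))%:E)%E.

Definition Vn {R : realType} (n : nat) : R :=
  powR pi (n%:R / 2) / Gamma (n%:R / 2 + 1).

Definition Rn {R : realType} (n : nat) (delta : R) : R :=
  powR (delta / Vn n) (n%:R^-1).

Definition fcd {R : realType} (n : nat) (c delta : R) (x : vec R n) : R :=
  if Rn n delta < enorm x then powR (enorm x) (- (2 * c * n%:R)) else 0.

(* The integral I_y of Theorem 5.4 (indices of eps and y are 1-based;
   only indices 1 .. l-2 are used). *)
Definition Iy {R : realType} (n : nat) (c delta : R) (l l1 l2 l3 : nat)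
  (eps : nat -> R) (y : nat -> vec R n) : \bar R :=
  ((powR (Vn n) (- (2 * l%:R * c)))%:E *
   intRn (fun x1 : vec R n => intRn (fun x2 : vec R n =>
     (fcd c delta x1
      * (\prod_(1 <= i < l1) fcd c delta (vadd (vscale (eps i) x1) (y i)))
      * fcd c delta x2
      * (\prod_(l1 <= i < l1 + l2 - 1) fcd c delta (vadd (vscale (eps i) x2) (y i)))
      * (\prod_(l1 + l2 - 1 <= i < l1 + l2 + l3 - 1)
            fcd c delta (vadd (vscale (eps i) (vadd x1 x2)) (y i)))
      * (\prod_(l1 + l2 + l3 - 1 <= i < l - 1)
            fcd c delta (vadd (vscale (eps i) (vsub x1 x2)) (y i))))%:E)))%E.

(* Main.v *)
(* Write g = V_n^{-2c} f, so that g is a function of the volume v = V_n |x|^n, namely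
   v^{-2c} for v > delta; hence sup g and the integral of g^2 over R^n are bounded
   independently of n.  Bounding all but four factors by sup g, what remains is
   the integral of (g(x1) g(x2)) (g(e (x1 + x2) + y) g(e' (x1 - x2) + y')).  By
   Cauchy-Schwarz this is at most the product of two L^2 norms on R^{2n}; the
   first is ||g||^2, and the second is 2^{-n/2} ||g||^2 because (x1, x2) |->
   (x1 + x2, x1 - x2) has determinant of absolute value 2^n.  So rho = 2^{-1/2}.
   The identity vol(ball r) = V_n r^n comes from a layer-cake decomposition of
   the Gaussian integral. *)
Require Import Defs.
From HB Require Import structures.
From mathcomp Require Import all_boot all_order all_algebra.
From mathcomp Require Import all_classical all_reals all_analysis.
From mathcomp Require Import measurable_realfun ring lra zify.
Import Order.TTheory GRing.Theory Num.Theory.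
Import numFieldNormedType.Exports.
Local Open Scope classical_set_scope.
Local Open Scope ring_scope.

(** * Iterated integrals *)

HB.instance Definition _ (R : realType) n := gen_eqMixin (vec R n).
HB.instance Definition _ (R : realType) n := gen_choiceMixin (vec R n).
HB.instance Definition _ (R : realType) n :=
  isPointed.Build (vec R n) (fun=> 0).

Definition coord_cylinders (R : realType) (n : nat) : set (set (vec R n)) :=
  \bigcup_i preimage_set_system setT (fun x : vec R n => x i) measurable.

(** The functions of [vec R n] under the product sigma-algebra, the smallest one making all
    coordinates measurable. No measure is attached: integration remains the iterated [intRn]. *)
Definition mvec (R : realType) (n : nat) :=
  g_sigma_algebraType (coord_cylinders R n).

HB.instance Definition _ (R : realType) n := Measurable.on (mvec R n).

(** Universal property of the product sigma-algebra: preimages need only be tested on the generating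
    cylinders. *)
Lemma measurable_mvecP {R : realType} {n : nat} {d} {X : measurableType d}
    (u : X -> mvec R n) :
  measurable_fun setT u <-> forall i, measurable_fun setT (fun x => u x i).
Proof.
split=> [mu i|mu].
  apply: (measurableT_comp (f := fun v : mvec R n => v i) _ mu) => _ A mA.
  by apply: sub_sigma_algebra; exists i => //; exists A.
apply: (@measurability _ _ X (mvec R n) setT u (coord_cylinders R n)) => //.
move=> _ [_ [i _ [A mA <-]] <-]; rewrite !setTI.
by rewrite -[X in measurable X]setTI; exact: mu.
Qed.

Lemma measurable_coord {R : realType} {n : nat} {d} {X : measurableType d}
    {u : X -> mvec R n} i :
  measurable_fun setT u -> measurable_fun setT (fun x => u x i).
Proof. by move=> /measurable_mvecP. Qed.

Lemma measurable_vcons {R : realType} {n : nat} {d} {X : measurableType d}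
    {t : X -> R} {u : X -> mvec R n} :
  measurable_fun setT t -> measurable_fun setT u ->
  measurable_fun setT (fun x => vcons (t x) (u x) : mvec R n.+1).
Proof.
move=> mt mu; apply/measurable_mvecP => i; rewrite /vcons.
by case: unliftP => [j _|_] //; exact: measurable_coord.
Qed.

Lemma intRn_ge0 {R : realType} {n : nat} (F : vec R n -> \bar R) :
  (forall v, 0 <= F v)%E -> (0 <= intRn F)%E.
Proof.
elim: n F => [|n IH] F F0 /=; first exact: F0.
by apply: integral_ge0 => t _; exact: IH.
Qed.

Lemma eq_intRn {R : realType} {n : nat} (F G : vec R n -> \bar R) :
  F =1 G -> intRn F = intRn G.
Proof. by move=> /funext ->. Qed.

Lemma measurable_fun_comp2 {d dX dY dZ} {W : measurableType d}
    {X : measurableType dX} {Y : measurableType dY} {Z : measurableType dZ}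
    {F : X -> Y -> Z} {p : W -> X} {q : W -> Y} :
  measurable_fun setT (fun w : X * Y => F w.1 w.2) ->
  measurable_fun setT p -> measurable_fun setT q ->
  measurable_fun setT (fun w => F (p w) (q w)).
Proof.
move=> mF mp mq.
exact: (measurableT_comp mF (measurable_fun_pair mp mq)).
Qed.

(** The parameter space [X] is kept general because the induction enlarges it: the first coordinate
    joins the parameters, so [X] becomes [X * R]. *)
Lemma measurable_intRn {R : realType} {n : nat} {d} {X : measurableType d}
    (F : X -> mvec R n -> \bar R) :
  measurable_fun setT (fun p : X * mvec R n => F p.1 p.2) ->
  (forall x v, 0 <= F x v)%E ->
  measurable_fun setT (fun x => intRn (F x)).
Proof.
elim: n d X F => [|n IH] d X F mF F0 /=.
  by apply: (measurable_fun_comp2 (Y := mvec R 0) mF) => //; exact: measurable_cst.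
apply: (measurable_fun_fubini_tonelli_F
  (fun p : X * measurableTypeR R => intRn (fun v => F p.1 (vcons p.2 v)))).
- apply: (IH _ _ (fun p v => F p.1 (vcons p.2 v))) => //.
  apply: (measurable_fun_comp2 (Y := mvec R n.+1) mF).
    exact: measurableT_comp.
  by apply: measurable_vcons => //; exact: measurableT_comp.
- by move=> p; apply: intRn_ge0.
Qed.

(** Two-variable Tonelli moves [t] past the first coordinate, and induction moves it past the
    remaining ones. *)
Lemma intRn_Tonelli1 {R : realType} {n : nat} (F : R -> mvec R n -> \bar R) :
  measurable_fun setT (fun p : measurableTypeR R * mvec R n => F p.1 p.2) ->
  (forall x v, 0 <= F x v)%E ->
  (\int[lebesgue_measure]_(t in setT) intRn (F t) =
   intRn (fun v => \int[lebesgue_measure]_(t in setT) F t v))%E.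
Proof.
elim: n F => [|n IH] F mF F0 //=.
rewrite (fubini_tonelli (fun p : measurableTypeR R * measurableTypeR R =>
    intRn (fun v => F p.1 (vcons p.2 v)))) /=.
- apply: eq_integral => s _; apply: (IH (fun t v => F t (vcons s v))) => //.
  apply: (measurable_fun_comp2 (Y := mvec R n.+1) mF) => //.
  by apply: measurable_vcons => //; exact: measurable_cst.
- apply: (measurable_intRn (X := (measurableTypeR R * measurableTypeR R)%type)
     (fun p v => F p.1 (vcons p.2 v))) => //.
  apply: (measurable_fun_comp2 (Y := mvec R n.+1) mF).
    exact: measurableT_comp.
  by apply: measurable_vcons => //; exact: measurableT_comp.
- by move=> p; apply: intRn_ge0.
Qed.

(** Induction on [m]: the tail of [x] is moved past [v] first, then the leading coordinate by
    [intRn_Tonelli1]. *)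
Lemma intRn_Tonelli {R : realType} {m n : nat}
    (F : mvec R m -> mvec R n -> \bar R) :
  measurable_fun setT (fun p : mvec R m * mvec R n => F p.1 p.2) ->
  (forall x v, 0 <= F x v)%E ->
  intRn (fun x => intRn (F x)) = intRn (fun v => intRn (F^~ v)).
Proof.
elim: m F => [|m IH] F mF F0 //=.
under eq_integral => t _.
  rewrite (IH (fun x => F (vcons t x))) //; last first.
    apply: (measurable_fun_comp2 (X := mvec R m.+1) mF) => //.
    by apply: measurable_vcons => //; exact: measurable_cst.
  over.
apply: (intRn_Tonelli1 (fun t v => intRn (fun u => F (vcons t u) v))).
- apply: (measurable_intRn (X := (measurableTypeR R * mvec R n)%type)
    (fun p u => F (vcons p.1 u) p.2)) => //.
  apply: (measurable_fun_comp2 (X := mvec R m.+1) mF).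
    by apply: measurable_vcons => //; exact: measurableT_comp.
  exact: measurableT_comp.
- by move=> t v; exact: intRn_ge0.
Qed.

Lemma measurable_vconsr {R : realType} {n : nat} {F : mvec R n.+1 -> \bar R} t :
  measurable_fun setT F ->
  measurable_fun setT ((fun v => F (vcons t v)) : mvec R n -> _).
Proof.
by move=> mF; exact: (measurableT_comp mF (measurable_vcons
  (measurable_cst t) (@measurable_id _ (mvec R n) setT))).
Qed.

Lemma measurable_intRn_vcons {R : realType} {n : nat} {F : mvec R n.+1 -> \bar R} :
  measurable_fun setT F -> (forall v, 0 <= F v)%E ->
  measurable_fun setT (fun t : measurableTypeR R => intRn (fun v => F (vcons t v))).
Proof.
move=> mF F0; apply: (measurable_intRn (X := measurableTypeR R)
  (fun t v => F (vcons t v))) => //.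
by exact: (measurableT_comp mF (measurable_vcons
  (@measurable_fst _ _ (measurableTypeR R) (mvec R n))
  (@measurable_snd _ _ (measurableTypeR R) (mvec R n)))).
Qed.

Lemma le_intRn {R : realType} {n : nat} (F G : mvec R n -> \bar R) :
  measurable_fun setT F -> measurable_fun setT G ->
  (forall v, 0 <= F v)%E -> (forall v, F v <= G v)%E ->
  (intRn F <= intRn G)%E.
Proof.
elim: n F G => [|n IH] F G mF mG F0 FG /=; first exact: FG.
have G0 v : (0 <= G v)%E by exact: le_trans (FG v).
apply: ge0_le_integral => //.
- by move=> t _; exact: intRn_ge0.
- exact: measurable_intRn_vcons.
- exact: measurable_intRn_vcons.
- by move=> t _; apply: IH => //; exact: measurable_vconsr.
Qed.

Lemma intRnD {R : realType} {n : nat} (F G : mvec R n -> \bar R) :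
  measurable_fun setT F -> measurable_fun setT G ->
  (forall v, 0 <= F v)%E -> (forall v, 0 <= G v)%E ->
  (intRn (fun v => F v + G v) = intRn F + intRn G)%E.
Proof.
elim: n F G => [|n IH] F G mF mG F0 G0 //=.
rewrite -ge0_integralD //.
- by apply: eq_integral => t _; apply: IH => //; exact: measurable_vconsr.
- by move=> t _; exact: intRn_ge0.
- exact: measurable_intRn_vcons.
- by move=> t _; exact: intRn_ge0.
- exact: measurable_intRn_vcons.
Qed.

Lemma intRnZl {R : realType} {n : nat} (k : \bar R) (F : mvec R n -> \bar R) :
  measurable_fun setT F -> (0 <= k)%E -> (forall v, 0 <= F v)%E ->
  (intRn (fun v => k * F v) = k * intRn F)%E.
Proof.
elim: n F => [|n IH] F mF k0 F0 //=.
rewrite -ge0_integralZl //.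
- by apply: eq_integral => t _; apply: IH => //; exact: measurable_vconsr.
- exact: measurable_intRn_vcons.
- by move=> t _; exact: intRn_ge0.
Qed.

Lemma intRn_nneseries {R : realType} {n : nat} (F : nat -> mvec R n -> \bar R) :
  (forall k, measurable_fun setT (F k)) -> (forall k v, 0 <= F k v)%E ->
  (intRn (fun v => \sum_(k <oo) F k v) = \sum_(k <oo) intRn (F k))%E.
Proof.
elim: n F => [|n IH] F mF F0 //=.
rewrite -integral_nneseries //.
- by apply: eq_integral => t _; apply: IH => // k; exact: measurable_vconsr.
- by move=> k; exact: measurable_intRn_vcons.
- by move=> k t _; exact: intRn_ge0.
Qed.

(** * Affine changes of variables *)

Lemma measurable_affine {R : realType} (a b : R) :
  measurable_fun setT ((fun t => a * t + b) : measurableTypeR R -> measurableTypeR R).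
Proof. by apply: measurable_funD => //; apply: measurable_funM. Qed.

(** By uniqueness of Lebesgue measure, half-open intervals suffice; the weight |a| compensates the
    length of their preimages. *)
Lemma lebesgue_measure_affine {R : realType} (a b : R) (A : set R) :
  a != 0 -> measurable A ->
  pushforward (mscale (NngNum (normr_ge0 a)) (@lebesgue_measure R))
    ((fun t => a * t + b) : measurableTypeR R -> measurableTypeR R) A =
  lebesgue_measure A.
Proof.
move=> a0 mA; apply/esym/lebesgue_measure_unique => //=.
  exact: measurable_affine.
move=> _ _ [[u v]] _ <-; rewrite /pushforward/= /mscale /=.
have [ap|an] := ltP 0 a.
  have -> : (fun t => a * t + b) @^-1` `]u, v] = `](u - b) / a, (v - b) / a]%classic.
    apply/seteqP; split=> t /=; rewrite !in_itv /= ltr_pdivrMr // ler_pdivlMr //;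
      rewrite ltrBlDr lerBrDr mulrC //.
  rewrite !lebesgue_measure_itv /= !lte_fin ltr_pM2r ?invr_gt0 // ltrD2r.
  case: ifP => _; last by rewrite mule0.
  by rewrite -EFinB -EFinM gtr0_norm //; congr EFin; field.
have {}an : a < 0 by rewrite lt_neqAle a0.
(* A negative slope reverses the interval, so the closed end is now on the left; the length is
   unaffected. *)
have -> : (fun t => a * t + b) @^-1` `]u, v] = `[(v - b) / a, (u - b) / a[%classic.
  apply/seteqP; split=> t /=; rewrite !in_itv /= ltr_ndivlMr // ler_ndivrMr //;
    rewrite ltrBlDr lerBrDr mulrC andbC //.
rewrite !lebesgue_measure_itv /= !lte_fin ltr_nM2r ?invr_lt0 // ltrD2r.
case: ifP => _; last by rewrite mule0.
by rewrite -EFinB -EFinM ltr0_norm //; congr EFin; field.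
Qed.

Lemma integral_affine {R : realType} (a b : R) (f : measurableTypeR R -> \bar R) :
  a != 0 -> measurable_fun setT f -> (forall t, 0 <= f t)%E ->
  (\int[lebesgue_measure]_(t in setT) f (a * t + b)%R =
   `|a|^-1%:E * \int[lebesgue_measure]_(t in setT) f t)%E.
Proof.
move=> a0 mf f0.
pose phi : measurableTypeR R -> measurableTypeR R := fun t => a * t + b.
have mphi : measurable_fun setT phi := measurable_affine a b.
rewrite [X in (_ * X)%E](_ : _ = \int[pushforward
  (mscale (NngNum (normr_ge0 a)) (@lebesgue_measure R)) phi]_(t in setT) f t)%E.
  rewrite ge0_integral_pushforward //= ge0_integral_mscale //=.
  - by rewrite preimage_setT muleA -EFinM mulVf ?normr_eq0 // mul1e.
  - by rewrite preimage_setT.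
  - by rewrite preimage_setT; exact: measurableT_comp.
by apply: eq_measure_integral => A mA _; exact/esym/lebesgue_measure_affine.
Qed.

Lemma vcons_affine {R : realType} {n : nat} (a t : R) (v : vec R n) (y : vec R n.+1) :
  vadd (vscale a (vcons t v)) y =
  vcons (a * t + y ord0) (vadd (vscale a v) (fun j => y (lift ord0 j))).
Proof.
apply/funext => i; rewrite /vadd /vscale /vcons.
by case: unliftP => [j|] ->.
Qed.

(** The map acts on each coordinate separately, and each one contributes a factor 1/|a|. *)
Lemma intRn_affine {R : realType} {n : nat} (a : R) (y : vec R n)
    (F : mvec R n -> \bar R) :
  a != 0 -> measurable_fun setT F -> (forall v, 0 <= F v)%E ->
  (intRn (fun v => F (vadd (vscale a v) y)) = (`|a|^-1 ^+ n)%:E * intRn F)%E.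
Proof.
move=> a0; elim: n y F => [|n IH] y F mF F0 /=.
  (* In dimension zero all vectors coincide, since ['I_0] is empty. *)
  by rewrite expr0 mul1e; congr F; apply/funext => -[].
under eq_integral => t _.
  under eq_intRn do rewrite vcons_affine.
  rewrite (IH _ (fun v => F (vcons (a * t + y ord0) v))) //; last first.
    exact: measurable_vconsr.
  over.
rewrite /= ge0_integralZl //.
- rewrite (integral_affine _ _ (fun t => intRn (fun v => F (vcons t v)))) //.
  + by rewrite muleA -EFinM -exprSr.
  + exact: measurable_intRn_vcons.
  + by move=> t; exact: intRn_ge0.
- exact: (measurableT_comp (measurable_intRn_vcons mF F0) (measurable_affine _ _)).
- by move=> t _; exact: intRn_ge0.
Qed.

(** * Volume of balls *)

Lemma enorm_ge0 {R : realType} {n : nat} (x : vec R n) : 0 <= enorm x.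
Proof. exact: sqrtr_ge0. Qed.

Lemma sqr_enorm {R : realType} {n : nat} (x : vec R n) :
  enorm x ^+ 2 = \sum_(i < n) x i ^+ 2.
Proof. by rewrite sqr_sqrtr // sumr_ge0 // => i _; exact: sqr_ge0. Qed.

(** The zero translation gives the argument the shape produced by [intRn_affine]. *)
Lemma enorm_scale {R : realType} {n : nat} (a : R) (x : vec R n) :
  enorm (vadd (vscale a x) (fun=> 0)) = `|a| * enorm x.
Proof.
rewrite /enorm -sqrtr_sqr -sqrtrM ?sqr_ge0 // mulr_sumr.
by congr Num.sqrt; apply: eq_bigr => i _; rewrite /vadd /vscale addr0 exprMn.
Qed.

Lemma measurable_sqr_enorm {R : realType} {n : nat} :
  measurable_fun setT (fun x : mvec R n => enorm x ^+ 2).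
Proof.
under eq_fun do rewrite sqr_enorm.
apply: measurable_sum => i; apply: measurable_funX.
exact: (measurable_coord (u := id)).
Qed.

Lemma measurable_enorm {R : realType} {n : nat} :
  measurable_fun setT (fun x : mvec R n => enorm x).
Proof.
rewrite (_ : (fun x => _) = (fun x : mvec R n => (enorm x ^+ 2) `^ (2^-1))).
  exact: (measurableT_comp (measurable_powR _) measurable_sqr_enorm).
by apply/funext => x; rewrite powR12_sqrt ?sqr_ge0 // sqrtr_sqr ger0_norm // enorm_ge0.
Qed.

(** Extended-real valued, as finiteness only follows from the Gaussian computation below. *)
Definition ball_volume {R : realType} (n : nat) (r : R) : \bar R :=
  intRn (fun x : vec R n => (if enorm x < r then 1 else 0)%:E).

Lemma measurable_ball_ind {R : realType} {n : nat} (r : R) :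
  measurable_fun setT (fun x : mvec R n => (if enorm x < r then 1 else 0 : R)%:E).
Proof.
apply/measurable_EFinP; apply: measurable_fun_ifT => //.
by apply: measurable_fun_ltr => //; exact: measurable_enorm.
Qed.

Lemma ball_ind_ge0 {R : realType} {n : nat} (r : R) (x : vec R n) :
  (0 <= (if enorm x < r then 1 else 0 : R)%:E)%E.
Proof. by rewrite lee_fin; case: ifP. Qed.

Lemma ball_volume_ge0 {R : realType} (n : nat) (r : R) : (0 <= ball_volume n r)%E.
Proof. by apply: intRn_ge0 => x; exact: ball_ind_ge0. Qed.

Lemma ball_volume_scale {R : realType} (n : nat) (r : R) : 0 < r ->
  (ball_volume n r = (r ^+ n)%:E * ball_volume n 1)%E.
Proof.
move=> r0; rewrite /ball_volume.
have := intRn_affine r^-1 (fun=> 0) _ _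
  (measurable_ball_ind (n := n) 1) (ball_ind_ge0 1).
rewrite invr_eq0 gt_eqF // => /(_ isT).
rewrite ger0_norm ?invr_ge0 ?ltW // invrK => <-.
apply: eq_intRn => x; rewrite enorm_scale ger0_norm ?invr_ge0 ?ltW //.
by rewrite mulrC ltr_pdivrMr // mul1r.
Qed.

(** The Gaussian factorises over the coordinates, and each one-dimensional integral equals
    sqrt(pi). *)
Lemma intRn_gauss {R : realType} (n : nat) :
  intRn (fun x : vec R n => (expR (- enorm x ^+ 2))%:E) = (Num.sqrt pi ^+ n)%:E.
Proof.
elim: n => [|n IH] /=; first by rewrite sqr_enorm big_ord0 oppr0 expR0.
under eq_integral => t _.
  rewrite (eq_intRn _ (fun v => (expR (- t ^+ 2))%:E * (expR (- enorm v ^+ 2))%:E)%E).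
    rewrite intRnZl; first over.
    - apply/measurable_EFinP; apply: measurableT_comp => //.
      by apply: measurableT_comp => //; exact: measurable_sqr_enorm.
    - by rewrite lee_fin expR_ge0.
    - by move=> v; rewrite lee_fin expR_ge0.
  move=> v; rewrite -EFinM -expRD !sqr_enorm big_ord_recl /= /vcons unlift_none.
  rewrite opprD; congr (expR (_ - _))%:E.
  by apply: eq_bigr => i _; rewrite liftK.
rewrite IH /=.
under eq_integral do rewrite muleC.
rewrite ge0_integralZl //=.
- by rewrite integralT_gauss -EFinM exprSr.
- by apply/measurable_EFinP; exact: measurable_gauss_fun.
Qed.

Lemma continuous_expRN {R : realType} : continuous (fun x : R^o => expR (- x)).
Proof.
by move=> x; apply: continuous_comp; [exact: opp_continuous|exact: continuous_expR].
Qed.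

(** With s = |x|^2 this spreads the Gaussian over the levels t > |x|^2, the first step of the
    layer-cake argument. *)
Lemma integral_expR_tail {R : realType} (s : R) :
  (\int[lebesgue_measure]_(t in setT) (if (s < t)%R then expR (- t) else 0)%:E =
   (expR (- s))%:E)%E.
Proof.
transitivity (\int[lebesgue_measure]_(t in `]s, +oo[) (expR (- t))%:E)%E.
  rewrite [RHS]integral_mkcond; apply: eq_integral => t _.
  by rewrite patchE mem_setE in_itv /= andbT; case: ifP.
rewrite integral_itv_obnd_cbnd; last first.
  by apply/measurable_EFinP/measurable_funTS; apply: measurableT_comp.
rewrite (@ge0_continuous_FTC2y _ _ (fun x => - expR (- x)) _ 0) //.
- by rewrite EFinN oppeK add0e.
- exact: (continuous_subspaceT continuous_expRN).
- by rewrite -oppr0; apply: cvgN; exact: cvgr_expR.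
- by apply: cvgN; apply: cvg_at_right_filter; exact: continuous_expRN.
- move=> x _ /=.
  by rewrite derive1E deriveN // derive_val; rewrite ?mulrN1 ?opprK.
Qed.

Lemma intRn_cst0 {R : realType} (n : nat) :
  intRn (fun _ : vec R n => 0%E) = 0%E :> \bar R.
Proof.
elim: n => [|n IH] //=; rewrite (eq_intRn _ (fun=> 0%E)) //.
by apply: integral0_eq => t _.
Qed.

(** For t > 0 the section is the ball of radius sqrt(t), of volume t^(n/2) times that of the unit
    ball. The exponent is left as n/2 + 1 - 1 to match the integrand of [Gamma] at n/2 + 1. *)
Lemma gauss_layer {R : realType} (n : nat) (t : R) :
  (intRn (fun x : vec R n => (if enorm x ^+ 2 < t then expR (- t) else 0)%:E) =
   (if (0 < t)%R then (t `^ (n%:R / 2 + 1 - 1) * expR (- t))%:E * ball_volume n 1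
    else 0))%E.
Proof.
case: ifPn => t0; last first.
  rewrite -[RHS](intRn_cst0 n); apply: eq_intRn => x.
  by rewrite ltNge (le_trans _ (sqr_ge0 _)) // leNgt.
rewrite addrK -[n%:R / 2]mulrC powRrM powR12_sqrt ?ltW // powR_mulrn ?sqrtr_ge0 //.
rewrite mulrC EFinM -muleA -ball_volume_scale ?sqrtr_gt0 // -intRnZl.
- apply: eq_intRn => x.
  rewrite -[in _ ^+ 2 < t](sqr_sqrtr (ltW t0)) ltr_pXn2r ?nnegrE ?enorm_ge0 ?sqrtr_ge0 //.
  by case: ifP => _; rewrite ?mule1 ?mule0.
- exact: measurable_ball_ind.
- by rewrite lee_fin expR_ge0.
- exact: ball_ind_ge0.
Qed.

(* Layer cake: the superlevel set {exp(-|x|^2) > exp(-t)} is the ball of radius sqrt t. *)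
Lemma ball_volume_Gamma {R : realType} (n : nat) :
  ((\int[@lebesgue_measure R]_(t in [set t : R | (0 < t)%R])
      (t `^ (n%:R / 2 + 1 - 1) * expR (- t))%:E) * ball_volume n 1 =
  (Num.sqrt pi ^+ n)%:E)%E.
Proof.
pose F (t : R) (x : mvec R n) := (if enorm x ^+ 2 < t then expR (- t) else 0)%:E.
have mF : measurable_fun setT (fun p : measurableTypeR R * mvec R n => F p.1 p.2).
  apply/measurable_EFinP; apply: measurable_fun_ifT => //.
    apply: measurable_fun_ltr => //.
    exact: (measurableT_comp measurable_sqr_enorm).
  by apply: measurableT_comp => //; exact: measurableT_comp.
have F0 t x : (0 <= F t x)%E by rewrite lee_fin; case: ifP => // _; exact: expR_ge0.
(* The Gaussian becomes a double integral in (t, x); integrating over x first leaves the Gamma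
   integrand times the volume of the unit ball. *)
rewrite -intRn_gauss.
under [RHS]eq_intRn do rewrite -integral_expR_tail.
rewrite -(intRn_Tonelli1 F mF F0).
under [RHS]eq_integral do rewrite gauss_layer.
rewrite muleC -ge0_integralZl //.
- rewrite [LHS]integral_mkcond; apply: eq_integral => t _.
  rewrite patchE; case: ifPn => [|/negP] /[!inE] /= t0.
    by rewrite t0 muleC.
  by rewrite ifN //; exact/negP.
- rewrite (_ : [set t | 0 < t] = `]0, +oo[%classic) //.
  by apply/seteqP; split=> t /=; rewrite in_itv /= andbT.
- apply/measurable_EFinP; apply: measurable_funTS; apply: measurable_funM.
    exact: measurable_powR.
  exact: measurableT_comp.
- by move=> t _; rewrite lee_fin mulr_ge0 ?powR_ge0 ?expR_ge0.
- exact: ball_volume_ge0.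
Qed.

(** The Gamma integral g and the volume b satisfy g b = pi^(n/2), with a finite positive right-hand
    side; this forces both to be finite and nonzero, so that b is the quotient defining [Vn]. *)
Lemma Vn_gt0_ball_volume1 {R : realType} (n : nat) :
  0 < Vn n :> R /\ ball_volume n 1 = (Vn n : R)%:E.
Proof.
have := ball_volume_Gamma (R := R) n.
have := ball_volume_ge0 (R := R) n 1.
have pn : Num.sqrt pi ^+ n = pi `^ (n%:R / 2) :> R.
  by rewrite -[n%:R / 2]mulrC powRrM powR12_sqrt ?pi_ge0 // powR_mulrn //.
rewrite /Vn /Gamma pn.
have : 0 < pi `^ (n%:R / 2) :> R by rewrite powR_gt0 // pi_gt0.
set p := pi `^ _.
have : (0 <= \int[@lebesgue_measure R]_(t in [set t : R | (0 < t)%R])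
      (t `^ (n%:R / 2 + 1 - 1) * expR (- t))%:E)%E.
  by apply: integral_ge0 => t _; rewrite lee_fin mulr_ge0 ?powR_ge0 ?expR_ge0.
(* [fine] would turn an infinite Gamma integral into 0, so infinite values must be excluded:
   infinity times 0 is 0 and infinity times a positive number is infinity, neither of which is
   pi^(n/2). *)
move: (integral _ _ _) (ball_volume n 1) => [g| |] [b| |] //=.
- rewrite !lee_fin => g0 p0 b0 [gb].
  have gn0 : g != 0 by apply: contraTneq p0 => g00; rewrite -gb g00 mul0r ltxx.
  split; first by rewrite divr_gt0 // lt_neqAle eq_sym gn0.
  by rewrite -gb mulrC mulKf.
- rewrite lee_fin le_eqVlt => /predU1P[<- p0 _|g0 _ _].
    by rewrite mul0e => -[p00]; rewrite -p00 ltxx in p0.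
  by rewrite gt0_muley.
- move=> _ p0; rewrite lee_fin le_eqVlt => /predU1P[<-|b0].
    by rewrite mule0 => -[p00]; rewrite -p00 ltxx in p0.
  by rewrite gt0_mulye.
Qed.

Lemma Vn_gt0 {R : realType} (n : nat) : 0 < Vn n :> R.
Proof. by case: (Vn_gt0_ball_volume1 (R := R) n). Qed.

Lemma ball_volume1 {R : realType} (n : nat) : ball_volume n 1 = (Vn n : R)%:E.
Proof. by case: (Vn_gt0_ball_volume1 (R := R) n). Qed.

(** In the variable v = V_n |x|^n, Lebesgue measure on R^n becomes length on the half-line. This is
    why the later bounds do not depend on n. *)
Lemma intRn_volume_lt {R : realType} (n : nat) (s : R) : (0 < n)%N -> 0 < s ->
  intRn (fun x : vec R n => (if Vn n * enorm x ^+ n < s then 1 else 0)%:E) = s%:E.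
Proof.
move=> n0 s0.
have V0 := Vn_gt0 (R := R) n.
have q0 : 0 < s / Vn n by rewrite divr_gt0.
have r0 : 0 < (s / Vn n) `^ n%:R^-1 by rewrite powR_gt0.
have rn : ((s / Vn n) `^ n%:R^-1) ^+ n = s / Vn n.
  rewrite -powR_mulrn ?powR_ge0 // -powRrM mulVf ?powRr1 ?ltW //.
  by rewrite pnatr_eq0 -lt0n.
transitivity (ball_volume n ((s / Vn n) `^ n%:R^-1)).
  apply: eq_intRn => x.
  rewrite -[enorm x < _](ltr_pXn2r n0) ?nnegrE ?enorm_ge0 ?(ltW r0) // rn.
  by rewrite ltr_pdivlMr // mulrC.
rewrite ball_volume_scale // rn ball_volume1 -EFinM.
by rewrite divfK // gt_eqF.
Qed.

(** * Size of f_{c,delta} *)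

Lemma Rn_lt_enorm {R : realType} {n : nat} (delta : R) (x : vec R n) :
  (0 < n)%N -> 0 < delta ->
  (Rn n delta < enorm x) = (delta < Vn n * enorm x ^+ n).
Proof.
move=> n0 d0; have V0 := Vn_gt0 (R := R) n.
have q0 : 0 < delta / Vn n by rewrite divr_gt0.
rewrite -(ltr_pXn2r n0) ?nnegrE ?enorm_ge0 ?powR_ge0 //.
rewrite /Rn -[_ `^ _ ^+ n]powR_mulrn ?powR_ge0 // -powRrM mulVf ?pnatr_eq0 -?lt0n //.
by rewrite powRr1 ?(ltW q0) // ltr_pdivrMr // mulrC.
Qed.

(** As a function of v, f depends on n only through the factor V_n^(2c), which the normalisation of
    [Iy] cancels. *)
Lemma fcd_volume {R : realType} {n : nat} (c delta : R) (x : vec R n) :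
  (0 < n)%N -> 0 < delta ->
  fcd c delta x = if delta < Vn n * enorm x ^+ n then
    Vn n `^ (2 * c) * (Vn n * enorm x ^+ n) `^ (- (2 * c)) else 0.
Proof.
move=> n0 d0; rewrite /fcd Rn_lt_enorm //; case: ifP => // _.
have V0 := Vn_gt0 (R := R) n.
rewrite powRM ?exprn_ge0 ?enorm_ge0 ?(ltW V0) // mulrA -powRD; last first.
  by rewrite (gt_eqF V0) implybT.
rewrite subrr powRr0 mul1r -powR_mulrn ?enorm_ge0 // -powRrM.
by congr (_ `^ _); rewrite mulrN mulrC.
Qed.

Lemma fcd_ge0 {R : realType} {n : nat} (c delta : R) (x : vec R n) :
  0 <= fcd c delta x.
Proof. by rewrite /fcd; case: ifP => // _; exact: powR_ge0. Qed.

Lemma ler_powR_neg {R : realType} (a x y : R) : a <= 0 -> 0 < x -> x <= y ->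
  y `^ a <= x `^ a.
Proof.
move=> a0 x0 xy; rewrite -[a]opprK !(powRN _ (- a)).
by rewrite lef_pV2 ?posrE ?powR_gt0 // ?(lt_le_trans x0) // ge0_ler_powR ?oppr_ge0
  ?nnegrE ?(ltW x0) // ltW // (lt_le_trans x0).
Qed.

Lemma fcd_le {R : realType} {n : nat} (c delta : R) (x : vec R n) :
  (0 < n)%N -> 0 < delta -> 0 <= c ->
  fcd c delta x <= Vn n `^ (2 * c) * delta `^ (- (2 * c)).
Proof.
move=> n0 d0 c0; rewrite fcd_volume //; case: ifP => [dv|_].
  apply: ler_wpM2l; first exact: powR_ge0.
  by apply: ler_powR_neg (ltW dv); rewrite // oppr_le0 mulr_ge0.
by rewrite mulr_ge0 // powR_ge0.
Qed.

(** Write v^(-4c) = v^(2-4c) v^(-2). Since c >= 1/2, the first factor is at most delta^(2-4c) on v >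
    delta, which leaves the fixed integrable power v^(-2). *)
Lemma sqr_fcd_le {R : realType} {n : nat} (c delta : R) (x : vec R n) :
  (0 < n)%N -> 0 < delta -> 2^-1 <= c ->
  fcd c delta x ^+ 2 <= Vn n `^ (2 * c) ^+ 2 * delta `^ (2 - 4 * c) *
    (if delta < Vn n * enorm x ^+ n then (Vn n * enorm x ^+ n) ^- 2 else 0).
Proof.
move=> n0 d0 c0; rewrite fcd_volume //; case: ifP => [dv|_]; last by rewrite mulr0 expr0n.
set v := _ * _ in dv *.
have v0 : 0 < v := lt_trans d0 dv.
rewrite exprMn -mulrA ler_wpM2l ?sqr_ge0 // -[v `^ _ ^+ 2]powR_mulrn ?powR_ge0 // -powRrM.
rewrite (_ : - (2 * c) * 2 = (2 - 4 * c) + - 2); last by ring.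
rewrite powRD ?(gt_eqF v0) ?implybT // powR_invn ?(ltW v0) //.
by rewrite ler_wpM2r ?invr_ge0 ?exprn_ge0 ?(ltW v0) // ler_powR_neg // ?(ltW dv) //; lra.
Qed.

Lemma measurable_fcd {R : realType} {n : nat} (c delta : R) :
  measurable_fun setT (fun x : mvec R n => fcd c delta x).
Proof.
rewrite /fcd; apply: measurable_fun_ifT => //.
  by apply: measurable_fun_ltr => //; exact: measurable_enorm.
exact: (measurableT_comp (measurable_powR _) measurable_enorm).
Qed.

(* [k] is the index of the dyadic shell containing [v]. *)
Lemma inv_sqr_dyadic {R : realType} (delta v : R) : 0 < delta -> delta < v ->
  exists k, v < 2 ^+ k.+1 * delta /\ v ^- 2 <= delta ^- 2 / 4 ^+ k.
Proof.
move=> d0 dv.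
have ex : exists j, v < 2 ^+ j * delta.
  exists (Num.bound (v / delta)); rewrite -ltr_pdivrMr //.
  apply: lt_trans (archi_boundP _) _; first by rewrite divr_ge0 // ltW // (lt_trans d0).
  by rewrite -natrX ltr_nat ltn_expl.
(* The least j with v < 2^j delta is positive because delta < v; with j = k + 1, minimality gives
   2^k delta <= v. *)
case: (ex_minnP ex) => -[|k] vk mk; first by rewrite mul1r ltNge (ltW dv) in vk.
exists k; split => //.
have kv : 2 ^+ k * delta <= v.
  by rewrite leNgt; apply/negP => /mk; rewrite ltnn.
have p0 : 0 < 2 ^+ k * delta by rewrite mulr_gt0 // exprn_gt0.
rewrite -invfM lef_pV2 ?posrE ?mulr_gt0 ?exprn_gt0 // ?(lt_le_trans p0) //.
rewrite (_ : 4 = 2 ^+ 2); last by ring.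
rewrite -exprM mulnC exprM -exprMn mulrC lerXn2r ?nnegrE // ?(ltW p0) //.
by rewrite ltW // (lt_le_trans p0).
Qed.

(** The k-th dyadic shell lies in {v < 2^(k+1) delta}, of volume 2^(k+1) delta, and there v^(-2) <=
    delta^(-2) 4^(-k). The contributions 2^(1-k)/delta sum to 4/delta. *)
Lemma intRn_inv_sqr_volume {R : realType} (n : nat) (delta : R) :
  (0 < n)%N -> 0 < delta ->
  (intRn (fun x : vec R n => (if (delta < Vn n * enorm x ^+ n)%R
     then (Vn n * enorm x ^+ n) ^- 2 else 0)%:E) <= (4 / delta)%:E)%E.
Proof.
move=> n0 d0; have V0 := Vn_gt0 (R := R) n.
pose v (x : mvec R n) : R := Vn n * enorm x ^+ n.
have mv : measurable_fun setT v.
  by apply: measurable_funM => //; apply: measurable_funX; exact: measurable_enorm.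
pose a k (x : mvec R n) : \bar R :=
  ((delta ^- 2 / 4 ^+ k)%:E * (if (v x < 2 ^+ k.+1 * delta)%R then 1 else 0)%:E)%E.
have i0 k x : (0 <= (if (v x < 2 ^+ k.+1 * delta)%R then 1 else 0 : R)%:E)%E.
  by rewrite lee_fin; case: ifP.
have mi k : measurable_fun setT
    (fun x => (if (v x < 2 ^+ k.+1 * delta)%R then 1 else 0 : R)%:E).
  apply/measurable_EFinP; apply: measurable_fun_ifT => //.
  exact: measurable_fun_ltr.
have c0 k : 0 <= delta ^- 2 / 4 ^+ k.
  by rewrite divr_ge0 ?invr_ge0 ?exprn_ge0 // ltW.
have a0 k x : (0 <= a k x)%E by rewrite mule_ge0 // lee_fin.
have ma k : measurable_fun setT (a k) by apply: measurable_funeM.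
apply: (@le_trans _ _ (intRn (fun x => \sum_(k <oo) a k x)%E)).
  apply: le_intRn.
  - apply/measurable_EFinP; apply: measurable_fun_ifT => //.
      exact: measurable_fun_ltr.
    rewrite (_ : (fun x => _) = (fun x => v x `^ (- 2%:R))).
      exact: (measurableT_comp (measurable_powR _) mv).
    by apply/funext => x; rewrite powR_invn // mulr_ge0 ?exprn_ge0 ?enorm_ge0 // ltW.
  - exact: ge0_emeasurable_sum.
  - by move=> x; rewrite lee_fin; case: ifP => // _; rewrite invr_ge0 sqr_ge0.
  - move=> x; case: ifP => [dv|_]; last by apply: nneseries_ge0.
    have [k [vk le]] := inv_sqr_dyadic _ _ d0 dv.
    (* The single term indexed by the shell of x already dominates the integrand. *)
    rewrite (nneseriesD1 (n := k)) //.
    rewrite (le_trans _ (leeDl _ _)) //; last by apply: nneseries_ge0.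
    by rewrite /a /v vk mule1 lee_fin.
rewrite intRn_nneseries //.
(* The geometric series is taken in the form of the sum of (4/delta) / 2^(k+1). *)
apply: le_trans (epsilon_trick0 xpredT _); last by rewrite divr_ge0 // ltW.
apply: lee_nneseries => [k _ _|k _]; first exact: intRn_ge0.
rewrite intRnZl // ?lee_fin //.
rewrite intRn_volume_lt // ?mulr_gt0 ?exprn_gt0 // -EFinM lee_fin.
rewrite le_eqVlt; apply/orP; left; apply/eqP.
rewrite (_ : 4 ^+ k = 2 ^+ k * 2 ^+ k :> R); last first.
  by rewrite -exprMn; congr (_ ^+ _); ring.
rewrite natrX (exprS 2 k); field.
by rewrite expf_neq0 ?pnatr_eq0 // gt_eqF.
Qed.

Lemma intRn_sqr_fcd_le {R : realType} (n : nat) (c delta : R) :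
  (0 < n)%N -> 0 < delta -> 2^-1 <= c ->
  (intRn (fun x : vec R n => (fcd c delta x ^+ 2)%:E) <=
   (Vn n `^ (2 * c) ^+ 2 * delta `^ (2 - 4 * c) * (4 / delta))%:E)%E.
Proof.
move=> n0 d0 c0; rewrite EFinM.
have k0 : 0 <= Vn n `^ (2 * c) ^+ 2 * delta `^ (2 - 4 * c) :> R.
  by rewrite mulr_ge0 ?sqr_ge0 ?powR_ge0.
set k := _ * _ `^ _ in k0 *.
pose h (x : mvec R n) : R := if delta < Vn n * enorm x ^+ n
     then (Vn n * enorm x ^+ n) ^- 2 else 0.
have mh : measurable_fun setT h.
  apply: measurable_fun_ifT => //.
  - apply: measurable_fun_ltr => //; apply: measurable_funM => //.
    by apply: measurable_funX; exact: measurable_enorm.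
  - rewrite (_ : (fun x => _) = (fun x => (Vn n * enorm x ^+ n) `^ (- 2%:R))).
      apply: (measurableT_comp (measurable_powR _)); apply: measurable_funM => //.
      by apply: measurable_funX; exact: measurable_enorm.
    apply/funext => x; rewrite powR_invn // mulr_ge0 ?exprn_ge0 ?enorm_ge0 //.
    by rewrite ltW // Vn_gt0.
have h0 x : 0 <= h x by rewrite /h; case: ifP => // _; rewrite invr_ge0 sqr_ge0.
apply: (@le_trans _ _ (k%:E * intRn (fun x => (h x)%:E))%E); last first.
  by apply: lee_wpmul2l; rewrite ?lee_fin //; exact: intRn_inv_sqr_volume.
have meh : measurable_fun setT (fun x => (h x)%:E) by exact/measurable_EFinP.
have eh0 x : (0 <= (h x)%:E)%E by rewrite lee_fin.
rewrite -(intRnZl k%:E _ meh _ eh0) ?lee_fin //.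
apply: le_intRn.
- by apply/measurable_EFinP; apply: measurable_funX; exact: measurable_fcd.
- exact: measurable_funeM.
- by move=> x; rewrite lee_fin sqr_ge0.
- by move=> x; rewrite -EFinM lee_fin; exact: sqr_fcd_le.
Qed.

(** * The four-factor estimate *)

Lemma measurable_vadd {R : realType} {n : nat} {d} {X : measurableType d}
    {u v : X -> mvec R n} :
  measurable_fun setT u -> measurable_fun setT v ->
  measurable_fun setT (fun x => vadd (u x) (v x) : mvec R n).
Proof.
move=> mu mv; apply/measurable_mvecP => i.
by apply: measurable_funD; exact: measurable_coord.
Qed.

Lemma measurable_vscale {R : realType} {n : nat} {d} {X : measurableType d}
    (a : R) {u : X -> mvec R n} :
  measurable_fun setT u -> measurable_fun setT (fun x => vscale a (u x) : mvec R n).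
Proof.
move=> mu; apply/measurable_mvecP => i.
by apply: measurable_funM => //; exact: measurable_coord.
Qed.

Lemma measurable_vsub {R : realType} {n : nat} {d} {X : measurableType d}
    {u v : X -> mvec R n} :
  measurable_fun setT u -> measurable_fun setT v ->
  measurable_fun setT (fun x => vsub (u x) (v x) : mvec R n).
Proof.
move=> mu mv; apply/measurable_mvecP => i.
by apply: measurable_funB; exact: measurable_coord.
Qed.

Lemma measurable_section {dX dY dZ} {X : measurableType dX} {Y : measurableType dY}
    {Z : measurableType dZ} {F : X -> Y -> Z} x :
  measurable_fun setT (fun p : X * Y => F p.1 p.2) -> measurable_fun setT (F x).
Proof. by move=> mF; apply: (measurable_fun_comp2 mF). Qed.

Section double_integral.
Context {R : realType} {n : nat}.
Implicit Types F G : mvec R n -> mvec R n -> \bar R.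
Local Open Scope ereal_scope.

Lemma le_intRn2 F G :
  measurable_fun setT (fun p : mvec R n * mvec R n => F p.1 p.2) ->
  measurable_fun setT (fun p : mvec R n * mvec R n => G p.1 p.2) ->
  (forall x v, 0 <= F x v) -> (forall x v, F x v <= G x v) ->
  intRn (fun x => intRn (F x)) <= intRn (fun x => intRn (G x)).
Proof.
move=> mF mG F0 FG.
have G0 x v : 0 <= G x v by exact: le_trans (FG x v).
apply: le_intRn; [exact: measurable_intRn|exact: measurable_intRn| |].
- by move=> x; exact: intRn_ge0.
- by move=> x; apply: le_intRn => //; exact: (measurable_section (X := mvec R n)).
Qed.

Lemma intRnD2 F G :
  measurable_fun setT (fun p : mvec R n * mvec R n => F p.1 p.2) ->
  measurable_fun setT (fun p : mvec R n * mvec R n => G p.1 p.2) ->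
  (forall x v, 0 <= F x v) -> (forall x v, 0 <= G x v) ->
  intRn (fun x => intRn (fun v => F x v + G x v)) =
  intRn (fun x => intRn (F x)) + intRn (fun x => intRn (G x)).
Proof.
move=> mF mG F0 G0; rewrite -intRnD.
- apply: eq_intRn => x; apply: intRnD => //.
  + exact: (measurable_section (X := mvec R n) x mF).
  + exact: (measurable_section (X := mvec R n) x mG).
- exact: measurable_intRn.
- exact: measurable_intRn.
- by move=> x; exact: intRn_ge0.
- by move=> x; exact: intRn_ge0.
Qed.

Lemma intRnZl2 (k : \bar R) F :
  measurable_fun setT (fun p : mvec R n * mvec R n => F p.1 p.2) ->
  0 <= k -> (forall x v, 0 <= F x v) ->
  intRn (fun x => intRn (fun v => k * F x v)) = k * intRn (fun x => intRn (F x)).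
Proof.
move=> mF k0 F0; rewrite -intRnZl //.
- by apply: eq_intRn => x; apply: intRnZl => //; exact: (measurable_section (X := mvec R n) x mF).
- exact: measurable_intRn.
- by move=> x; exact: intRn_ge0.
Qed.

Lemma intRn_prod (f g : mvec R n -> \bar R) :
  measurable_fun setT f -> measurable_fun setT g ->
  (forall v, 0 <= f v) -> (forall v, 0 <= g v) ->
  intRn (fun x => intRn (fun v => f x * g v)) = intRn f * intRn g.
Proof.
move=> mf mg f0 g0.
rewrite (eq_intRn _ (fun x => intRn g * f x)); last first.
  by move=> x; rewrite intRnZl // muleC.
by rewrite intRnZl // 1?muleC //; exact: intRn_ge0.
Qed.

(* The linear map (x1, x2) |-> (x1 + x2, x1 - x2) has determinant of absolute value 2^n. *)
Lemma intRn_sum_diff (f g : mvec R n -> \bar R) (e e' : R) (y y' : vec R n) :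
  measurable_fun setT f -> measurable_fun setT g ->
  (forall v, 0 <= f v) -> (forall v, 0 <= g v) ->
  (e = 1 \/ e = -1)%R -> (e' = 1 \/ e' = -1)%R ->
  intRn (fun x1 => intRn (fun x2 =>
    f (vadd (vscale e (vadd x1 x2)) y) * g (vadd (vscale e' (vsub x1 x2)) y'))) =
  ((2^-1)%R ^+ n)%:E * (intRn f * intRn g).
Proof.
move=> mf mg f0 g0 he he'.
have e1 : (`|e| = 1)%R by case: he => ->; rewrite ?normrN normr1.
have e'1 : (`|e'| = 1)%R by case: he' => ->; rewrite ?normrN normr1.
have ee : (e * e = 1)%R by case: he => ->; ring.
have en0 : (e != 0)%R by rewrite -normr_eq0 e1 oner_eq0.
have e'n0 : (2 * e' != 0)%R by rewrite mulf_neq0 // ?pnatr_eq0 // -normr_eq0 e'1 oner_eq0.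
(* Put w = e (x1 + x2) + y. As e^2 = 1, x1 - x2 = 2 x1 - e (w - y), so the argument of g is 2 e' x1
   + z(w). *)
pose z (w : vec R n) : vec R n := vadd (vscale (- (e' * e)) (vsub w y)) y'.
have mz : measurable_fun setT (z : mvec R n -> mvec R n).
  apply: measurable_vadd => //; apply: measurable_vscale; exact: measurable_vsub.
pose G (x1 w : mvec R n) := f w * g (vadd (vscale (2 * e') x1) (z w)).
have mG : measurable_fun setT (fun p : mvec R n * mvec R n => G p.1 p.2).
  apply: emeasurable_funM.
    exact: (measurableT_comp mf).
  apply: (measurableT_comp mg); apply: measurable_vadd.
    exact: measurable_vscale.
  exact: (measurableT_comp mz).
have G0 x1 w : 0 <= G x1 w by rewrite mule_ge0.
(* For fixed x1, the substitution of w for x2 has Jacobian of absolute value 1. *)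
rewrite (eq_intRn _ (fun x1 => intRn (G x1))); last first.
  move=> x1; rewrite -[RHS]mul1e.
  have := intRn_affine e (vadd (vscale e x1) y) (G x1) en0
    (measurable_section (X := mvec R n) x1 mG) (G0 x1).
  rewrite e1 invr1 expr1n => <-; apply: eq_intRn => x2; rewrite /G.
  congr (f _ * g _); apply/funext => i; rewrite /z /vadd /vscale /vsub; first by ring.
  rewrite (_ : - (e' * e) * (e * x2 i + (e * x1 i + y i) - y i) =
    - e' * (e * e) * (x2 i + x1 i))%R; last by ring.
  by rewrite ee; ring.
(* With w now outermost, x1 enters only through 2 e' x1 + z(w), and this scaling yields the factor
   2^(-n). *)
rewrite intRn_Tonelli //.
rewrite (eq_intRn _ (fun w => (((2^-1)%R ^+ n)%:E * intRn g) * f w)); last first.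
  move=> w; rewrite intRnZl //; last first.
    apply: (measurableT_comp mg); apply: measurable_vadd => //.
    exact: (measurable_vscale _ (u := id)).
  rewrite (intRn_affine _ _ g) // normrM e'1 mulr1 ger0_norm //.
  by rewrite muleC.
rewrite intRnZl //.
- by rewrite -muleA; congr (_ * _); rewrite muleC.
- by rewrite mule_ge0 ?intRn_ge0 // lee_fin exprn_ge0 // invr_ge0.
Qed.

End double_integral.

Lemma amgm_weighted {R : realType} (s a b : R) : 0 < s ->
  a * b <= s / 2 * a ^+ 2 + s^-1 / 2 * b ^+ 2.
Proof.
move=> s0; rewrite -subr_ge0.
rewrite (_ : _ - _ = s^-1 / 2 * (s * a - b) ^+ 2).
  by rewrite mulr_ge0 ?sqr_ge0 // divr_ge0 // invr_ge0 ltW.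
by field; rewrite gt_eqF.
Qed.

(* Cauchy--Schwarz, in the form of AM-GM with weight 2^(-n/2). *)
Lemma intRn_four_factors {R : realType} (n : nat) (f : mvec R n -> R) (N : R)
    (e e' : R) (y y' : vec R n) :
  measurable_fun setT f -> (forall v, 0 <= f v) -> 0 <= N ->
  (intRn (fun v => (f v ^+ 2)%:E) <= N%:E)%E ->
  e = 1 \/ e = -1 -> e' = 1 \/ e' = -1 ->
  (intRn (fun x1 => intRn (fun x2 => (f x1 * f x2 *
     (f (vadd (vscale e (vadd x1 x2)) y) *
      f (vadd (vscale e' (vsub x1 x2)) y')))%:E)) <=
   ((Num.sqrt 2)^-1 ^+ n * N ^+ 2)%:E)%E.
Proof.
move=> mf f0 N0 fN he he'.
(* The weight s = 2^(-n/2) balances the two squares: their integrals are at most N^2 and s^2 N^2,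
   and both weighted halves become s N^2 / 2. *)
set s : R := _^-1 ^+ n.
have s0 : 0 < s by rewrite exprn_gt0 // invr_gt0 sqrtr_gt0.
have ss : 2^-1 ^+ n = s * s :> R.
  by rewrite -exprMn -invfM -expr2 sqr_sqrtr.
pose h v : \bar R := (f v ^+ 2)%:E.
have mh : measurable_fun setT h by apply/measurable_EFinP; exact: measurable_funX.
have h0 v : (0 <= h v)%E by rewrite lee_fin sqr_ge0.
have hN : (intRn h * intRn h <= (N ^+ 2)%:E)%E.
  by rewrite expr2 EFinM lee_pmul // intRn_ge0.
have m1 : measurable_fun setT (fun p : mvec R n * mvec R n =>
    vadd (vscale e (vadd p.1 p.2)) y : mvec R n).
  by apply: measurable_vadd => //; apply: measurable_vscale; exact: measurable_vadd.
have m2 : measurable_fun setT (fun p : mvec R n * mvec R n =>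
    vadd (vscale e' (vsub p.1 p.2)) y' : mvec R n).
  by apply: measurable_vadd => //; apply: measurable_vscale; exact: measurable_vsub.
(* [A] and [B] are the squares of the two pairs of factors to which AM-GM is applied. *)
pose A (x1 x2 : mvec R n) := (h x1 * h x2)%E.
pose B (x1 x2 : mvec R n) : \bar R := (h (vadd (vscale e (vadd x1 x2)) y) *
  h (vadd (vscale e' (vsub x1 x2)) y'))%E.
have A0 x1 x2 : (0 <= A x1 x2)%E by rewrite mule_ge0.
have B0 x1 x2 : (0 <= B x1 x2)%E by rewrite mule_ge0.
have mA : measurable_fun setT (fun p : mvec R n * mvec R n => A p.1 p.2).
  by apply: emeasurable_funM; exact: (measurableT_comp mh).
have mB : measurable_fun setT (fun p : mvec R n * mvec R n => B p.1 p.2).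
  by apply: emeasurable_funM; [exact: (measurableT_comp mh m1)|exact: (measurableT_comp mh m2)].
have k1 : (0 <= (s / 2)%:E)%E by rewrite lee_fin divr_ge0 // ltW.
have k2 : (0 <= (s^-1 / 2)%:E)%E by rewrite lee_fin divr_ge0 // invr_ge0 ltW.
apply: (@le_trans _ _ (intRn (fun x1 => intRn (fun x2 =>
    (s / 2)%:E * A x1 x2 + (s^-1 / 2)%:E * B x1 x2)))%E).
  apply: le_intRn2.
  - apply/measurable_EFinP; apply: measurable_funM; apply: measurable_funM.
    + exact: (measurableT_comp mf).
    + exact: (measurableT_comp mf).
    + exact: (measurableT_comp mf m1).
    + exact: (measurableT_comp mf m2).
  - by apply: emeasurable_funD; apply: measurable_funeM.
  - by move=> x1 x2; rewrite lee_fin !mulr_ge0.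
  - move=> x1 x2; rewrite /A /B /h -!EFinM -EFinD lee_fin -!exprMn.
    exact: amgm_weighted.
rewrite intRnD2; last 4 first.
- exact: measurable_funeM.
- exact: measurable_funeM.
- by move=> x1 x2; rewrite mule_ge0.
- by move=> x1 x2; rewrite mule_ge0.
rewrite !intRnZl2 // intRn_prod // intRn_sum_diff // ss.
rewrite (_ : (s * N ^+ 2)%:E =
  (s / 2)%:E * (N ^+ 2)%:E + (s^-1 / 2)%:E * ((s * s)%:E * (N ^+ 2)%:E))%E; last first.
  by rewrite -!EFinM -EFinD; congr EFin; field; rewrite gt_eqF.
apply: leeD; first exact: lee_wpmul2l.
apply: lee_wpmul2l => //; apply: lee_wpmul2l => //.
by rewrite lee_fin mulr_ge0 // ltW.
Qed.

(** * Reduction of the full product to four factors *)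

Lemma prod_nat_le {R : realType} (g : nat -> R) (M : R) (a b : nat) :
  (forall i, 0 <= g i <= M) -> \prod_(a <= i < b) g i <= M ^+ (b - a).
Proof. by move=> gM; rewrite -prodr_const_nat; apply: ler_prod. Qed.

Lemma measurable_prod_nat {R : realType} {d} {X : measurableType d}
    (g : nat -> X -> R) (a b : nat) :
  (forall i, measurable_fun setT (g i)) ->
  measurable_fun setT (fun x => \prod_(a <= i < b) g i x).
Proof. by move=> mg; apply: measurable_prod => i _. Qed.

Theorem theorem5p4 (R : realType) (c delta : R) (l : nat) :
  2^-1 < c -> 0 < delta -> (4 <= l)%N ->
  exists K rho : R, 0 < K /\ 0 < rho < 1 /\
    forall (l1 l2 l3 l4 : nat),
      (0 < l1)%N -> (0 < l2)%N -> (0 < l3)%N -> (0 < l4)%N ->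
      (l1 + l2 + l3 + l4)%N = l ->
      forall (n : nat), (1 <= n)%N ->
      forall (eps : nat -> R) (y : nat -> vec R n),
        (forall i, (1 <= i <= l - 2)%N -> eps i = 1 \/ eps i = -1) ->
        (Iy c delta l l1 l2 l3 eps y <= (K * rho ^+ n)%:E)%E.
Proof.
move=> c2 d0 l4_le.
have c0 : 0 < c by apply: lt_trans c2; rewrite invr_gt0.
(* [D] bounds the integral of g^2, where g = V_n^(-2c) f. *)
pose D : R := delta `^ (2 - 4 * c) * (4 / delta).
have D0 : 0 < D by rewrite mulr_gt0 ?powR_gt0 // divr_gt0.
(* Each of the l - 4 discarded factors costs delta^(-2c), a bound for g; the four kept ones cost D^2
   2^(-n/2). *)
exists ((delta `^ (- (2 * c))) ^+ (l - 4) * D ^+ 2), (Num.sqrt 2)^-1.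
split; first by rewrite mulr_gt0 // exprn_gt0 // powR_gt0.
split.
  rewrite invr_gt0 sqrtr_gt0 ltr0n /= invf_lt1 ?sqrtr_gt0 ?ltr0n //.
  by rewrite -[X in X < _]sqrtr1 ltr_sqrt ?ltr0n // ltr1n.
move=> l1 l2 l3 l4 l1p l2p l3p l4p ll n n1 eps y he.
set q := _^-1 ^+ n.
have V0 : 0 < Vn n :> R := Vn_gt0 n.
pose V : R := Vn n `^ (2 * c).
have Vp : 0 < V by rewrite powR_gt0.
pose M : R := V * delta `^ (- (2 * c)).
have M0 : 0 <= M by rewrite mulr_ge0 ?powR_ge0.
pose f : mvec R n -> R := fcd c delta.
have fM v : 0 <= f v <= M by rewrite fcd_ge0 fcd_le // ltW.
have f0 v : 0 <= f v by exact: fcd_ge0.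
have mf : measurable_fun setT f by exact: measurable_fcd.
(* First indices of the sum and difference products; positivity of l3 and l4 makes both ranges
   nonempty, so these two factors can be kept. *)
pose a := (l1 + l2 - 1)%N; pose b := (l1 + l2 + l3 - 1)%N.
have ab : (a < b)%N by rewrite /a /b; lia.
have bl : (b < l - 1)%N by rewrite /b; lia.
pose P1 x1 := \prod_(1 <= i < l1) f (vadd (vscale (eps i) x1) (y i)).
pose P2 x2 := \prod_(l1 <= i < a) f (vadd (vscale (eps i) x2) (y i)).
(* A variable starting index lets the same notation serve before and after the leading factor is
   split off. *)
pose P3 s x1 x2 := \prod_(s <= i < b) f (vadd (vscale (eps i) (vadd x1 x2)) (y i)).
pose P4 s x1 x2 := \prod_(s <= i < l - 1) f (vadd (vscale (eps i) (vsub x1 x2)) (y i)).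
pose Q (x1 x2 : mvec R n) : R := f x1 * f x2 *
  (f (vadd (vscale (eps a) (vadd x1 x2)) (y a)) *
   f (vadd (vscale (eps b) (vsub x1 x2)) (y b))).
have mu (w : mvec R n * mvec R n -> mvec R n) i : measurable_fun setT w ->
    measurable_fun setT (fun p => f (vadd (vscale (eps i) (w p)) (y i))).
  move=> mw; apply: (measurableT_comp mf).
  by apply: measurable_vadd => //; exact: measurable_vscale.
have mD : measurable_fun setT (fun p : mvec R n * mvec R n => vadd p.1 p.2 : mvec R n).
  exact: measurable_vadd.
have mB : measurable_fun setT (fun p : mvec R n * mvec R n => vsub p.1 p.2 : mvec R n).
  exact: measurable_vsub.
have prod0 (g : nat -> mvec R n) s t : 0 <= \prod_(s <= i < t) f (g i).
  by apply: prodr_ge0.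
have prodM (g : nat -> mvec R n) s t : \prod_(s <= i < t) f (g i) <= M ^+ (t - s).
  exact: prod_nat_le.
have P1_0 x1 : 0 <= P1 x1 by exact: (prod0 (fun i => vadd _ (y i))).
have P2_0 x2 : 0 <= P2 x2 by exact: (prod0 (fun i => vadd _ (y i))).
have P3_0 s x1 x2 : 0 <= P3 s x1 x2 by exact: (prod0 (fun i => vadd _ (y i))).
have P4_0 s x1 x2 : 0 <= P4 s x1 x2 by exact: (prod0 (fun i => vadd _ (y i))).
have P1_M x1 : P1 x1 <= M ^+ (l1 - 1) by exact: (prodM (fun i => vadd _ (y i))).
have P2_M x2 : P2 x2 <= M ^+ (a - l1) by exact: (prodM (fun i => vadd _ (y i))).
have P3_M s x1 x2 : P3 s x1 x2 <= M ^+ (b - s) by exact: (prodM (fun i => vadd _ (y i))).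
have P4_M s x1 x2 : P4 s x1 x2 <= M ^+ (l - 1 - s) by exact: (prodM (fun i => vadd _ (y i))).
have mQ : measurable_fun setT (fun p : mvec R n * mvec R n => Q p.1 p.2).
  apply: measurable_funM; apply: measurable_funM.
  - exact: (measurableT_comp mf).
  - exact: (measurableT_comp mf).
  - exact: mu.
  - exact: mu.
have Q0 x1 x2 : 0 <= Q x1 x2 by rewrite /Q !mulr_ge0.
have Ml0 : (0 <= (M ^+ (l - 4))%:E)%E by rewrite lee_fin exprn_ge0.
have Vl0 : 0 <= Vn n `^ (- (2 * l%:R * c)) by exact: powR_ge0.
have main : (intRn (fun x1 : vec R n => intRn (fun x2 : vec R n =>
    (f x1 * P1 x1 * f x2 * P2 x2 * P3 a x1 x2 * P4 b x1 x2)%:E)) <=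
    (M ^+ (l - 4) * (q * (V ^+ 2 * D) ^+ 2))%:E)%E.
  apply: (@le_trans _ _ (intRn (fun x1 : mvec R n => intRn (fun x2 : mvec R n =>
      (M ^+ (l - 4))%:E * (Q x1 x2)%:E)))%E).
    apply: le_intRn2.
    - apply/measurable_EFinP; repeat apply: measurable_funM.
      + exact: (measurableT_comp mf).
      + by apply: measurable_prod_nat => i; exact: mu.
      + exact: (measurableT_comp mf).
      + by apply: measurable_prod_nat => i; exact: mu.
      + by apply: measurable_prod_nat => i; exact: mu.
      + by apply: measurable_prod_nat => i; exact: mu.
    - by apply: measurable_funeM; exact/measurable_EFinP.
    - by move=> x1 x2; rewrite lee_fin !mulr_ge0.
    - move=> x1 x2; rewrite -EFinM lee_fin.
      rewrite /P3 /P4 big_ltn // (big_ltn bl) -/(P3 a.+1 x1 x2) -/(P4 b.+1 x1 x2).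
      rewrite [leLHS](_ : _ = (P1 x1 * P2 x2 * P3 a.+1 x1 x2 * P4 b.+1 x1 x2) * Q x1 x2);
        last by rewrite /Q; ring.
      apply: ler_wpM2r => //.
      (* The four remaining products have l1 - 1, l2 - 1, l3 - 1 and l4 - 1 factors, each at most
         M. *)
      rewrite (_ : (l - 4 = (l1 - 1) + (a - l1) + (b - a.+1) + (l - 1 - b.+1))%N);
        last by rewrite /a /b; lia.
      rewrite !exprD; apply: ler_pM => //; first by rewrite !mulr_ge0.
      apply: ler_pM => //; first by rewrite !mulr_ge0.
      exact: ler_pM.
  rewrite intRnZl2 //; last exact/measurable_EFinP.
  rewrite EFinM; apply: lee_wpmul2l => //.
  apply: intRn_four_factors => //.
  - by rewrite mulr_ge0 ?sqr_ge0 // ltW.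
  - by rewrite /D mulrA; apply: intRn_sqr_fcd_le => //; exact: ltW.
  - by apply: he; rewrite /a; lia.
  - by apply: he; rewrite /b; lia.
rewrite /Iy; apply: le_trans (lee_wpmul2l _ main) _; first by rewrite lee_fin.
rewrite -EFinM lee_fin le_eqVlt; apply/orP; left; apply/eqP.
(* The powers of V cancel exactly: l - 4 of them come from the factors M and four from (V^2 D)^2. *)
have -> : Vn n `^ (- (2 * l%:R * c)) = (V ^+ l)^-1.
  by rewrite powRN -powR_mulrn ?(ltW Vp) // -powRrM mulrAC.
rewrite /M exprMn -[in V ^+ l](subnK l4_le) exprD.
by field; rewrite !expf_neq0 // gt_eqF.
Qed.
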